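(* Let $\Gamma$ be a finitely generated group generated by $S=\{s_1,\dots,s_n\}$ and let $\alpha:\Gamma\to\Gamma$ be an endomorphism of $\Gamma$. For $m\ge 1$ put $K_m=\max_{1\le i\le n}|\alpha^m(s_i)|_S$. Then: (1) $GR(\alpha)=\lim_{m\to\infty}\sqrt[m]{K_m}=\inf_{m}\sqrt[m]{K_m}$ (in particular the limit exists); (2) $GR(\alpha)\le k$, where $k$ is the maximum of the lengths $|\alpha(s_i)|_S$, $1\le i\le n$; (3) $GR(\alpha^p)=GR(\alpha)^p$ for every integer $p\ge 1$.
   Context: For a group $\Gamma$ with finite generating set $S$ and $\gamma\in\Gamma$, $|\gamma|_S$ denotes the length of the shortest word in the letters $S\cup S^{-1}$ representing $\gamma$. The growth rate of an endomorphism $\alpha:\Gamma\to\Gamma$ is $GR(\alpha)=\sup_{\gamma\in\Gamma}\ \limsup_{m\to\infty}\sqrt[m]{|\alpha^m(\gamma)|_S}$. *)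

(* Defs.v *)
From HB Require Import structures.
From mathcomp Require Import all_boot all_order all_algebra.
From mathcomp Require Import all_classical all_reals all_analysis.
Import numFieldNormedType.Exports.

Set Implicit Arguments.
Unset Strict Implicit.
Unset Printing Implicit Defensive.

Import Order.TTheory GRing.Theory Num.Theory.

Local Open Scope classical_set_scope.
Local Open Scope ring_scope.

Definition generates (Gamma : groupType) (n : nat) (s : 'I_n -> Gamma) : Prop :=
  forall H : {pred Gamma},
    group_closed H -> (forall i, s i \in H) -> forall g, g \in H.

Definition letter (Gamma : groupType) (n : nat) (s : 'I_n -> Gamma) : pred Gamma :=
  fun x => [exists i, (x == s i) || (x == (s i)^-1%g)].

Definition word_represents (Gamma : groupType) (n : nat) (s : 'I_n -> Gamma)
    (w : seq Gamma) (g : Gamma) : Prop :=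
  all (letter s) w /\ (\prod_(x <- w) x)%g = g.

Definition word_of_size (Gamma : groupType) (n : nat) (s : 'I_n -> Gamma)
    (g : Gamma) (k : nat) : bool :=
  `[< exists2 w : seq Gamma, size w = k & word_represents s w g >].

(* The value is 0 when no word represents [g]; this does not happen if [s]
   generates the group. *)
Definition word_length (Gamma : groupType) (n : nat) (s : 'I_n -> Gamma)
    (g : Gamma) : nat :=
  if pselect (exists k, word_of_size s g k) is left ex then ex_minn ex else 0%N.

(* The [m]-th root of a natural number, for [m >= 1]; at the junk index [m = 0]
   the exponent is [0^-1 = 0] and the value is 1. *)
Definition nat_root (R : realType) (m k : nat) : R := k%:R `^ m%:R^-1.

(* The value is extended real, since the supremum and the limits superior are
   not known to be finite a priori. *)
Definition growth_rate (R : realType) (Gamma : groupType) (n : nat)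
    (s : 'I_n -> Gamma) (f : Gamma -> Gamma) : \bar R :=
  ereal_sup (range (fun g : Gamma =>
    limn_esup (fun m : nat => (nat_root R m (word_length s (iter m f g)))%:E))).

(* The maximum over an empty generating family is 0. *)
Definition max_length (Gamma : groupType) (n : nat) (s : 'I_n -> Gamma)
    (f : Gamma -> Gamma) : nat :=
  (\max_(i < n) word_length s (f (s i)))%N.

(* Main.v *)
Require Import Defs.
From HB Require Import structures.
From mathcomp Require Import all_boot all_order all_algebra.
From mathcomp Require Import all_classical all_reals all_analysis.
Import numFieldNormedType.Exports.
Import Order.TTheory GRing.Theory Num.Theory.

Local Open Scope classical_set_scope.
Local Open Scope ring_scope.

(** Write [K m] for [max_length s (iter m f)]. Applying an endomorphism letter by
    letter to a geodesic word multiplies its length by at most the largest length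
    of the image of a generator ([word_length_endo]). Applied to [iter m f] and to
    the elements [iter p f (s i)], this gives [K (m + p) <= K m * K p], and applied
    to [iter m f] and [g] it gives [|f^m g| <= |g| * K m].

    By Fekete's lemma ([cvg_inf_root]), the roots of a submultiplicative sequence
    converge to their infimum [l]. The form used below is slightly stronger: for
    every [c > l] there is a constant [A] with [K m <= A * c ^+ m] for all [m]
    ([inf_root_geometric]). Such a bound passes to [|f^m g|] with the constant
    [|g| * A], and constants disappear under [m]-th roots, so every [g] has growth
    rate at most [l]. Conversely, if all generators had growth rate below some
    [c < l], then, there being finitely many of them, the root of [K m] would
    eventually be at most [c], below the infimum ([growth_rate_lt_near]). Hence the
    growth rate equals [l] ([growth_rate_inf]).

    The bound by [K 1] holds because [K 1] is one of the terms of the infimum. The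
    formula for powers holds because the sequence attached to [iter p f] is
    [K (m * p)], whose [m]-th root is the [p]-th power of a term of a subsequence
    of the roots of [K]. *)

(** * Word length *)

Section WordLength.
Local Set Implicit Arguments.
Local Unset Strict Implicit.
Context {Gamma : groupType} {n : nat} {s : 'I_n -> Gamma}.
Implicit Types (g h : Gamma) (v w : seq Gamma).

Lemma letterV g : letter s g -> letter s g^-1%g.
Proof.
case/existsP => i /orP[] /eqP ->; apply/existsP; exists i.
  by rewrite eqxx orbT.
by rewrite invgK eqxx.
Qed.

Lemma word_represents1 : word_represents s [::] 1%g.
Proof. by split; rewrite ?big_nil. Qed.

Lemma word_represents_letter g : letter s g -> word_represents s [:: g] g.
Proof. by move=> sg; split; rewrite /= ?sg ?big_seq1. Qed.

Lemma word_representsM v w g h : word_represents s v g ->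
  word_represents s w h -> word_represents s (v ++ w) (g * h)%g.
Proof.
by move=> [vs vg] [ws wh]; split; rewrite ?all_cat ?vs// big_cat vg wh.
Qed.

Lemma word_representsV w g : word_represents s w g ->
  exists2 v, size v = size w & word_represents s v g^-1%g.
Proof.
elim: w g => [|x w IHw] g [].
  by move=> _; rewrite big_nil => <-; exists [::]; rewrite // invg1;
    exact: word_represents1.
move=> /= /andP[sx sw]; rewrite big_cons => <-.
have [v vE vw] := IHw _ (conj sw erefl).
exists (v ++ [:: x^-1%g]); first by rewrite size_cat vE addn1.
rewrite invgM; apply: word_representsM => //.
exact/word_represents_letter/letterV.
Qed.

Lemma word_length_le_size w g :
  word_represents s w g -> (word_length s g <= size w)%N.
Proof.
move=> wg; rewrite /word_length; case: pselect => // ex.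
by case: ex_minnP => k _; apply; apply/asboolP; exists w.
Qed.

Context (hs : generates s).

Lemma geodesic_word g :
  exists2 w, size w = word_length s g & word_represents s w g.
Proof.
have [w wg] : exists w, word_represents s w g.
  pose H : {pred Gamma} := fun g => `[< exists w, word_represents s w g >].
  suff /asboolP : g \in H by [].
  apply: hs => [|i]; last first.
    apply/asboolP; exists [:: s i]; apply: word_represents_letter.
    by apply/existsP; exists i; rewrite eqxx.
  split; first by apply/asboolP; exists [::]; exact: word_represents1.
  move=> x y /asboolP[v vx] /asboolP[w /word_representsV[w' _ w'y]].
  by apply/asboolP; exists (v ++ w'); exact: word_representsM.
rewrite /word_length; case: pselect => [ex|nex]; last first.
  by exfalso; apply: nex; exists (size w); apply/asboolP; exists w.
by case: ex_minnP => k /asboolP[v vk vg] _; exists v.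
Qed.

Lemma word_length1 : word_length s 1%g = 0%N.
Proof. by apply/eqP; rewrite -leqn0 (word_length_le_size word_represents1). Qed.

Lemma word_lengthM g h :
  (word_length s (g * h)%g <= word_length s g + word_length s h)%N.
Proof.
have [[v <- vg] [w <- wh]] := (geodesic_word g, geodesic_word h).
by rewrite -size_cat; exact/word_length_le_size/word_representsM.
Qed.

Lemma word_lengthV g : (word_length s g^-1%g <= word_length s g)%N.
Proof.
have [w <- /word_representsV[v <- vg]] := geodesic_word g.
exact: word_length_le_size.
Qed.

Lemma word_length_generator (f : Gamma -> Gamma) i :
  (word_length s (f (s i)) <= max_length s f)%N.
Proof. exact: (@bigop.bigmax_sup _ i). Qed.

(** Applying [f] letter by letter to a geodesic word for [g] replaces each
    letter by a word of size at most [max_length s f]. *)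
Lemma word_length_endo (f : Gamma -> Gamma) g :
  {morph f : x y / (x * y)%g} ->
  (word_length s (f g) <= word_length s g * max_length s f)%N.
Proof.
move=> fM.
have f1 : f 1%g = 1%g by apply: (mulgI (f 1%g)); rewrite -fM !mulg1.
have fV x : f x^-1%g = (f x)^-1%g.
  by apply: (mulgI (f x)); rewrite -fM !mulgV.
have f_letter x : letter s x -> (word_length s (f x) <= max_length s f)%N.
  case/existsP => i /orP[] /eqP ->; first exact: word_length_generator.
  by rewrite fV (leq_trans (word_lengthV _))// word_length_generator.
have [w <- [sw <-]] := geodesic_word g.
elim: w sw => [|x w IHw] /=; first by rewrite big_nil f1 word_length1.
move=> /andP[sx sw]; rewrite big_cons fM mulSn.
by rewrite (leq_trans (word_lengthM _ _))// leq_add ?f_letter ?IHw.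
Qed.

Lemma max_length_comp (f g : Gamma -> Gamma) : {morph f : x y / (x * y)%g} ->
  (max_length s (f \o g) <= max_length s f * max_length s g)%N.
Proof.
move=> fM; apply/bigmax_leqP => i _.
rewrite (leq_trans (word_length_endo _ fM))// mulnC leq_mul2l; apply/orP; right.
exact: word_length_generator.
Qed.

End WordLength.

Lemma iter_morphM (Gamma : groupType) (f : Gamma -> Gamma) m :
  {morph f : x y / (x * y)%g} -> {morph iter m f : x y / (x * y)%g}.
Proof. by move=> fM; elim: m => [|m IHm] x y; rewrite ?iterS ?IHm ?fM. Qed.

(** * Roots of submultiplicative sequences *)

Definition inf_root (R : realType) (a : nat -> nat) : R :=
  inf [set nat_root R m (a m) | m in [set m | (1 <= m)%N]].

Section Roots.
Local Set Implicit Arguments.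
Local Unset Strict Implicit.
Context {R : realType}.
Implicit Types (a : nat -> nat) (c d : R).

Lemma nat_root_ge0 m k : 0 <= nat_root R m k.
Proof. exact: powR_ge0. Qed.

Lemma nat_root1 k : nat_root R 1 k = k%:R.
Proof. by rewrite /nat_root invr1 powRr1. Qed.

(** This holds at [m = 0] too, where both sides are 1, so that it can be used to
    rewrite whole sequences of roots. *)
Lemma nat_rootM m p k : (0 < p)%N -> nat_root R m k = nat_root R (m * p) k ^+ p.
Proof.
move=> p0; rewrite /nat_root -powR_mulrn ?powR_ge0// -powRrM natrM invfM.
by rewrite mulfVK// pnatr_eq0 -lt0n.
Qed.

Lemma nat_root_le m k d : (0 < m)%N -> 0 <= d ->
  (nat_root R m k <= d) = (k%:R <= d ^+ m).
Proof.
move=> m0 d0; have -> : k%:R = nat_root R m k ^+ m :> R.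
  by rewrite -(nat_root1 k) (@nat_rootM 1 m)// mul1n.
by rewrite ler_pXn2r// nnegrE ?nat_root_ge0.
Qed.

(** Divide the index by [q]: writing [m] as [q * t + r], submultiplicativity
    gives [a m <= a q ^ t * a r], and [A] absorbs the finitely many remainders. *)
Lemma submultiplicative_geometric a c q :
  (forall m p, (a (m + p) <= a m * a p)%N) ->
  (0 < q)%N -> 0 < c -> nat_root R q (a q) <= c ->
  exists A : R, forall m, (a m)%:R <= A * c ^+ m.
Proof.
move=> aM q0 c0; rewrite nat_root_le ?(ltW c0)// => aq.
exists (\sum_(r < q) (a r)%:R / c ^+ r) => m.
elim/ltn_ind: m => m IHm; have [mq|qm] := ltnP m q.
  rewrite -ler_pdivrMr ?exprn_gt0// (bigD1 (Ordinal mq))//= lerDl.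
  by apply: sumr_ge0 => i _; rewrite divr_ge0// exprn_ge0// ltW.
rewrite -(subnKC qm) exprD mulrCA.
rewrite (@le_trans _ _ ((a q)%:R * (a (m - q)%N)%:R))//.
  by rewrite -natrM ler_nat.
by rewrite ler_pM// IHm// ltn_subrL q0 (leq_trans q0).
Qed.

(** The constant [A] disappears under [m]-th roots, because
    [A * (c / d) ^+ m] tends to 0. *)
Lemma geometric_root_near a (A c d : R) : 0 < c -> c < d ->
  (forall m, (a m)%:R <= A * c ^+ m) ->
  \forall m \near \oo, nat_root R m (a m) <= d.
Proof.
move=> c0 cd aA; have d0 := lt_trans c0 cd.
have cvg0 : geometric A (c / d) @ \oo --> (0 : R).
  apply: cvg_geometric.
  by rewrite ger0_norm ?divr_ge0 ?ltW// ltr_pdivrMr// mul1r.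
near=> m.
have m0 : (0 < m)%N by near: m; exact: nbhs_infty_gt.
have : A * (c / d) ^+ m <= 1.
  by near: m; apply: (cvgr_le 0 cvg0) => //; exact: ltr01.
rewrite expr_div_n mulrA ler_pdivrMr ?exprn_gt0// mul1r => Acd.
by rewrite nat_root_le ?(ltW d0)// (le_trans (aA m)).
Unshelve. all: by end_near. Qed.

Lemma inf_root_le a m : (0 < m)%N -> inf_root R a <= nat_root R m (a m).
Proof.
move=> m0; apply: ge_inf; last by exists m.
by exists 0 => _ [k _ <-]; exact: nat_root_ge0.
Qed.

Lemma inf_root_ge0 a : 0 <= inf_root R a.
Proof.
apply: lb_le_inf; first by exists (nat_root R 1 (a 1%N)), 1%N.
by move=> _ [k _ <-]; exact: nat_root_ge0.
Qed.

Lemma inf_root_geometric a c : (forall m p, (a (m + p) <= a m * a p)%N) ->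
  inf_root R a < c -> exists A : R, forall m, (a m)%:R <= A * c ^+ m.
Proof.
move=> aM ac; have c0 := le_lt_trans (inf_root_ge0 a) ac.
have [_ [q q0 <-] /ltW aqc] : exists2 y,
    [set nat_root R m (a m) | m in [set m | (1 <= m)%N]] y & y < c.
  by apply: inf_lt ac; exists (nat_root R 1 (a 1%N)), 1%N.
exact: (@submultiplicative_geometric a c q).
Qed.

(** Fekete's lemma in multiplicative form: the infimum is a lower bound of the
    roots, and any [c] above it gives a geometric bound, hence eventually bounds
    the roots up to an arbitrarily small error. *)
Lemma cvg_inf_root a : (forall m p, (a (m + p) <= a m * a p)%N) ->
  (fun m => nat_root R m (a m)) @ \oo --> inf_root R a.
Proof.
move=> aM; apply/cvgrPdist_le => e e0.
have e20 : 0 < e / 2 by rewrite divr_gt0.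
have ac : inf_root R a < inf_root R a + e / 2 by rewrite ltrDl.
have cd : inf_root R a + e / 2 < inf_root R a + e.
  by rewrite ltrD2l ltr_pdivrMr// ltr_pMr// ltr1n.
have [A aA] := inf_root_geometric aM ac.
have c0 := le_lt_trans (inf_root_ge0 a) ac.
near=> m; rewrite distrC ger0_norm ?subr_ge0.
  rewrite lerBlDl; near: m.
  exact: geometric_root_near c0 cd aA.
by apply: inf_root_le; near: m; exact: nbhs_infty_gt.
Unshelve. all: by end_near. Qed.

Lemma limn_esup_le_near (v : nat -> \bar R) (l : \bar R) :
  (\forall m \near \oo, (v m <= l)%E) -> (limn_esup v <= l)%E.
Proof.
move=> vl; apply: ge_ereal_inf.
exists (ereal_sup (v @` [set m | (v m <= l)%E])).
  by exists [set m | (v m <= l)%E].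
by apply: ge_ereal_sup => _ [m vm <-].
Qed.

Lemma limn_esup_lt_near (v : nat -> \bar R) (l : \bar R) :
  (limn_esup v < l)%E -> \forall m \near \oo, (v m <= l)%E.
Proof.
move=> /ereal_inf_lt[_ [V V_oo <-] /ltW Vl].
apply: filterS V_oo => m Vm; apply: le_trans Vl.
by apply: ereal_sup_ubound; exists m.
Qed.

End Roots.

(** * Growth rate *)

Section GrowthRate.
Local Set Implicit Arguments.
Local Unset Strict Implicit.
Context {R : realType} {Gamma : groupType} {n : nat} {s : 'I_n -> Gamma}.
Context (hs : generates s).
Implicit Types f : Gamma -> Gamma.

Lemma max_length_iterD f : {morph f : x y / (x * y)%g} -> forall m p,
  (max_length s (iter (m + p) f) <=
    max_length s (iter m f) * max_length s (iter p f))%N.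
Proof.
move=> fM m p; rewrite (_ : iter (m + p) f = iter m f \o iter p f).
  exact/(max_length_comp hs)/iter_morphM.
by apply/funext => g; rewrite iterD.
Qed.

Lemma growth_rate_ge0 f : (0 <= growth_rate R s f)%E.
Proof.
apply: le_ereal_sup_tmp.
exists (limn_esup (fun m => (nat_root R m (word_length s (iter m f 1%g)))%:E)).
  by exists 1%g.
apply: limf_esup_ge0; first exact: filter_not_empty.
by move=> m; rewrite lee_fin nat_root_ge0.
Qed.

Lemma growth_rate_le f (A c : R) : {morph f : x y / (x * y)%g} -> 0 < c ->
  (forall m, (max_length s (iter m f))%:R <= A * c ^+ m) ->
  (growth_rate R s f <= c%:E)%E.
Proof.
move=> fM c0 fA; apply: ge_ereal_sup => _ [g _ <-].
apply/lee_addgt0Pr => e e0; rewrite -EFinD; apply: limn_esup_le_near.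
have gA m : (word_length s (iter m f g))%:R <= (word_length s g)%:R * A * c ^+ m.
  rewrite -mulrA (@le_trans _ _
    ((word_length s g)%:R * (max_length s (iter m f))%:R))//; last first.
    by rewrite ler_wpM2l.
  by rewrite -natrM ler_nat word_length_endo//; exact: iter_morphM.
have cce : c < c + e by rewrite ltrDl.
apply: filterS (geometric_root_near c0 cce gA) => m.
by rewrite lee_fin.
Qed.

(** If every generator has growth rate below [c], then, there being finitely many
    generators, the eventual bounds hold from a common index on. *)
Lemma growth_rate_lt_near f (c : R) : (growth_rate R s f < c%:E)%E ->
  \forall m \near \oo, nat_root R m (max_length s (iter m f)) <= c.
Proof.
move=> fc.
have c0 : 0 <= c by rewrite -lee_fin (le_trans (growth_rate_ge0 f))// ltW.
have near_gen : \forall m \near \oo, forall i,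
    nat_root R m (word_length s (iter m f (s i))) <= c.
  apply: filter_forall => i.
  have /limn_esup_lt_near : (limn_esup (fun m =>
      (nat_root R m (word_length s (iter m f (s i))))%:E) < c%:E)%E.
    by apply: le_lt_trans fc; apply: ereal_sup_ubound; exists (s i).
  by apply: filterS => m; rewrite lee_fin.
near=> m.
have m0 : (0 < m)%N by near: m; exact: nbhs_infty_gt.
rewrite nat_root_le// /max_length.
elim/big_ind : _ => [|j k jc kc|i _]; first by rewrite exprn_ge0.
  by rewrite /maxn; case: ifP.
by rewrite -nat_root_le//; move: i; near: m.
Unshelve. all: by end_near. Qed.

Lemma growth_rate_inf f : {morph f : x y / (x * y)%g} ->
  growth_rate R s f = (inf_root R (fun m => max_length s (iter m f)))%:E.
Proof.
move=> fM; have KM := max_length_iterD fM.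
pose K m := max_length s (iter m f).
apply/eqP; rewrite eq_le; apply/andP; split.
  apply/lee_addgt0Pr => e e0; rewrite -EFinD.
  have infc : inf_root R K < inf_root R K + e by rewrite ltrDl.
  have [A KA] := inf_root_geometric KM infc.
  apply: growth_rate_le KA => //.
  exact: le_lt_trans (inf_root_ge0 K) infc.
(* The midpoint of the growth rate and the infimum eventually bounds the roots,
   although no root of positive index lies below the infimum. *)
rewrite leNgt; apply/negP => ltinf.
have fin : growth_rate R s f \is a fin_num.
  by rewrite ge0_fin_numE ?growth_rate_ge0// (lt_trans ltinf)// ltry.
move: ltinf; rewrite -(fineK fin) lte_fin => /midf_lt[gc c_inf].
have : (growth_rate R s f < ((fine (growth_rate R s f) + inf_root R K) / 2)%:E)%E.
  by rewrite -[ltLHS](fineK fin) lte_fin.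
move=> /growth_rate_lt_near[N _ /(_ N.+1 (leqnSn N))/=]; apply/negP.
by rewrite -ltNge (lt_le_trans c_inf)// inf_root_le.
Qed.

End GrowthRate.

Theorem theorem2p1 (R : realType) (Gamma : groupType) (n : nat)
    (s : 'I_n -> Gamma) (hs : generates s)
    (alpha : UMagmaMorphism.type Gamma Gamma) :
  let u : nat -> R := fun m => nat_root R m (max_length s (iter m alpha)) in
  [/\ [/\ cvgn u,
          growth_rate R s alpha = (limn u)%:E &
          growth_rate R s alpha = (inf [set u m | m in [set m | (1 <= m)%N]])%:E],
      (growth_rate R s alpha <= (max_length s alpha)%:R%:E)%E &
      forall p : nat, (1 <= p)%N ->
        growth_rate R s (iter p alpha) = (growth_rate R s alpha ^+ p)%E].
Proof.
move=> u; have aM : {morph alpha : x y / (x * y)%g} by exact: gmulfM.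
pose K m := max_length s (iter m alpha).
have u_cvg : u @ \oo --> inf_root R K.
  exact/cvg_inf_root/max_length_iterD.
have GR_inf : growth_rate R s alpha = (inf_root R K)%:E.
  exact: growth_rate_inf.
split; first split.
- by apply/cvg_ex; exists (inf_root R K).
- by rewrite GR_inf (cvg_lim _ u_cvg).
- exact: GR_inf.
- by rewrite GR_inf lee_fin -(nat_root1 (max_length s alpha)) (@inf_root_le R K 1).
move=> p p0; have pM := @iter_morphM _ _ p aM.
rewrite growth_rate_inf// GR_inf -EFin_expe; congr EFin.
have u_subseq : (fun m => u (m * p)%N ^+ p) @ \oo --> inf_root R K ^+ p.
  apply: (@cvg_comp _ _ _ (fun m => u (m * p)%N) (fun x : R => x ^+ p) _
    (nbhs (inf_root R K))); last exact: exprn_continuous.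
  apply: (@cvg_comp _ _ _ (fun m => m * p)%N u _ \oo); last exact: u_cvg.
  exact: cvg_mulnr.
have v_cvg : (fun m => u (m * p)%N ^+ p) @ \oo -->
    inf_root R (fun m => max_length s (iter m (iter p alpha))).
  have <- : (fun m => nat_root R m (max_length s (iter m (iter p alpha)))) =
      (fun m => u (m * p)%N ^+ p).
    apply/funext => m; rewrite /u -nat_rootM//.
    congr (nat_root R m (max_length s _)).
    by apply/funext => g; rewrite iterM.
  exact/cvg_inf_root/max_length_iterD.
by rewrite -(cvg_lim _ v_cvg)// -(cvg_lim _ u_subseq).
Qed.
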